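(* Let $G'$ be the contracted graph of an arbitrary graph $G$ containing a hamilton circuit, and let $H'$ be a pseudo-hamilton circuit of $G'$ whose vertices are equally spaced clockwise along a circle $C$. Let $a$ be a pseudo-arc vertex of $H'$. Suppose $e_1=[H'(a),H'(d)]$ and $e_2=[d,H'(e)]$ are edges of $G'-H'$ which do not intersect in $C$, and that $[a,x]$ is an edge of $G'-H'$ determining a rotation $r$ of $H'$ such that $H'(a)$ is a pseudo-arc vertex of $H^*=H'r$. If, going in a clockwise direction along $H'$, $x$ lies between $H'(e)$ and $d$, then $e_1$ and $e_2$ intersect in the circle defined by $H^*$ and determine an $H^*$-admissible pseudo-3-cycle.
   Context: The contracted graph $G'$ of $G$: each maximal path of $G$ whose interior vertices all have degree $2$ is replaced by a single new vertex (a ''2-vertex'') adjacent to the neighbours of the path's endpoints, edges joining the two endpoints of such a path being deleted. A pseudo-hamilton circuit is a cyclic ordering of the vertex set ($H'(v)$ = successor of $v$); $v$ is a pseudo-arc vertex if $[v,H'(v)]$ is not an edge. Edges ''intersect'' in a circle if, drawn as chords between the equally spaced vertices, they cross. A rotation with respect to $a$ and $x$, for an edge $[a,x]$ not on $H'$, replaces the subpath $[a,H'(a),\dots,x]$ of $H'$ by $[a,x,\dots,H'(a)]$ (the segment from $H'(a)$ to $x$ reversed), the rest of the circuit unchanged. A pseudo-3-cycle $(p\,q\,z)$ determined by edges $[p,H^*(q)]$, $[q,H^*(z)]$ is $H^*$-admissible if $H^*(p\,q\,z)$ is again an $n$-cycle. *)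

(* Defs.v *)
From mathcomp Require Import all_boot all_order all_fingroup all_algebra.
From mathcomp Require Import all_classical all_reals all_analysis.

Set Implicit Arguments.
Unset Strict Implicit.
Unset Printing Implicit Defensive.

Import Order.TTheory GRing.Theory Num.Theory.
Local Open Scope classical_set_scope.
Local Open Scope ring_scope.

(* A finite simple graph is a symmetric irreflexive relation on a finType. *)

Definition hamiltonian (T : finType) (G : rel T) : Prop :=
  exists c : seq T, [/\ (2 < size c)%N, ucycle G c & forall v, v \in c].

Definition degree (T : finType) (G : rel T) (v : T) : nat := #|[set w | G v w]%SET|.

(* [path2 G u m v]: u :: rcons m v is a path of G, from u to v, with at least
   one interior vertex, and the interior vertices (those of m) have degree 2. *)
Definition path2 (T : finType) (G : rel T) (u : T) (m : seq T) (v : T) : bool :=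
  [&& m != [::], uniq (u :: rcons m v), path G u (rcons m v)
    & all (fun w => degree G w == 2) m].

(* A path that is properly contained in another such path can already be
   prolonged by one vertex at one of its ends. *)
Definition max_path2 (T : finType) (G : rel T) (u : T) (m : seq T) (v : T) : bool :=
  [&& path2 G u m v, [forall w, ~~ path2 G w (u :: m) v]
    & [forall w, ~~ path2 G u (rcons m v) w]].

(* The vertices of the contracted graph are represented by sets of vertices of
   G: a maximal path is represented by its set of vertices (so that a path and
   its reversal give the same 2-vertex), and a vertex lying on no such path by
   its singleton. *)
Definition two_vertex (T : finType) (G : rel T) (S : {set T}) : Prop :=
  exists u m v, max_path2 G u m v /\ S = [set w in u :: rcons m v]%SET.

Definition kept_vertex (T : finType) (G : rel T) (S : {set T}) : Prop :=
  exists2 w, S = [set w]%SET & ~ exists2 S', two_vertex G S' & w \in S'.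

Definition contracted_pred (T : finType) (G : rel T) (S : {set T}) : bool :=
  `[< two_vertex G S \/ kept_vertex G S >].

Definition contracted_vertex (T : finType) (G : rel T) : finType :=
  {S : {set T} | contracted_pred G S}.

(* The edges of G that do not join the two endpoints of a maximal path. *)
Definition kept_edge (T : finType) (G : rel T) (u v : T) : Prop :=
  G u v /\ ~ exists m, max_path2 G u m v \/ max_path2 G v m u.

(* u is an endpoint of the path represented by S, or the vertex itself when S
   represents a vertex on no maximal path. *)
Definition end_of (T : finType) (G : rel T) (S : {set T}) (u : T) : Prop :=
  (kept_vertex G S /\ S = [set u]%SET) \/
  (exists m v, (max_path2 G u m v \/ max_path2 G v m u) /\
     S = [set w in u :: rcons m v]%SET).

Definition end_reaches (T : finType) (G : rel T) (S S' : {set T}) : Prop :=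
  exists u v, [/\ end_of G S u, v \in S' & kept_edge G u v].

Definition contracted (T : finType) (G : rel T) : rel (contracted_vertex G) :=
  fun x y => (x != y) &&
    `[< end_reaches G (val x) (val y) \/ end_reaches G (val y) (val x) >].

(* A cyclic ordering of V, given by its successor function: a permutation
   consisting of a single cycle through all the vertices. *)
Definition ncycle (V : finType) (H : {perm V}) : Prop :=
  forall v w : V, w \in porbit H v.

Definition pseudo_arc_vertex (V : finType) (adj : rel V) (H : {perm V}) (v : V) : bool :=
  ~~ adj v (H v).

Definition edge_off (V : finType) (adj : rel V) (H : {perm V}) (e : V * V) : bool :=
  [&& adj e.1 e.2, H e.1 != e.2 & H e.2 != e.1].

(* Inclusive: x may coincide with u or with v. *)
Definition cw_between (V : finType) (H : {perm V}) (u x v : V) : bool :=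
  (findex H u x <= findex H u v)%N.

Definition rotation_seq (V : finType) (H : {perm V}) (a x : V) : seq V :=
  let s := behead (fingraph.orbit H a) in
  let k := (index x s).+1 in
  a :: rev (take k s) ++ drop k s.

Lemma rotation_seq_uniq (V : finType) (H : {perm V}) (a x : V) :
  uniq (rotation_seq H a x).
Proof.
rewrite /rotation_seq; set s := behead _; set k := _.+1.
have -> : uniq (a :: rev (take k s) ++ drop k s) = uniq (a :: s).
  apply: perm_uniq; rewrite perm_cons -{3}(cat_take_drop k s).
  by rewrite perm_cat2r perm_rev.
suff -> : a :: s = fingraph.orbit H a by apply: fingraph.orbit_uniq.
by rewrite /s /fingraph.orbit -orderSpred.
Qed.

(* With the circuit read as a, H a, ..., x, H x, ..., the segment from H a to x
   is reversed. *)
Definition rotation (V : finType) (H : {perm V}) (a x : V) : {perm V} :=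
  perm (can_inj (prev_next (rotation_seq_uniq H a x))).

(* p -> q -> z -> p when p, q, z are distinct. *)
Definition cycle3 (V : finType) (p q z : V) : {perm V} :=
  (tperm p q * tperm p z)%g.

Definition determines_pseudo_3cycle (V : finType) (adj : rel V) (H : {perm V})
    (e1 e2 : V * V) (p q z : V) : Prop :=
  [/\ uniq [:: p; q; z], adj p (H q), adj q (H z), e1 = (p, H q) & e2 = (q, H z)].

(* Products of permutations act from left to right in MathComp, so this is the
   permutation v |-> H ((p q z) v), with arcs [p, H q], [q, H z], [z, H p]. *)
Definition admissible3 (V : finType) (H : {perm V}) (p q z : V) : Prop :=
  ncycle (cycle3 p q z * H)%g.

(* R^o is R seen as a vector space over itself; this is the plane. *)
Definition plane (R : realType) := (R^o * R^o)%type.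

Definition circle_point (R : realType) (c : plane R) (r theta : R) : plane R :=
  (c.1 + r * cos theta, c.2 + r * sin theta).

(* The vertices are at the points P v, equally spaced on the circle of centre c
   and radius r, the angle decreasing by 2 pi / n from a vertex to its
   successor. *)
Definition clockwise_on (R : realType) (V : finType) (H : {perm V})
    (c : plane R) (r : R) (P : V -> plane R) : Prop :=
  0 < r /\ exists (v0 : V) (theta : R), forall k : nat,
    P (iter k H v0) = circle_point c r (theta - k%:R * (2 * pi / #|V|%:R)).

Definition chord (R : realType) (V : finType) (P : V -> plane R) (e : V * V) :
    set (plane R) :=
  [set (1 - t) *: P e.1 + t *: P e.2 | t in `[0, 1]].

(* Chords are closed segments: chords with a common endpoint intersect. *)
Definition chords_intersect (R : realType) (V : finType) (P : V -> plane R)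
    (e1 e2 : V * V) : Prop :=
  chord P e1 `&` chord P e2 !=set0.

(* Main.v *)
(* Number the vertices by their distance from a along H. Non-crossing of e1 and
   e2 forces the positions 1, j, i, i + 1 of H(a), H(e), d, H(d) to satisfy
   1 < j < i, and the position k of x satisfies j <= k <= i. Here k = i is
   excluded, because H*(H(a)) would be H(d) and H(a) would not be a pseudo-arc
   vertex of H*. The rotation sends position m to k + 1 - m for 1 <= m <= k and
   fixes the others, so along H* the vertices H(e), H(a), d, H(d) have positions
   k + 1 - j < k < i < i + 1: the chords alternate, hence cross, and the
   pseudo-3-cycle is (p q z) with p, q, z at positions k, i, k - j. Since these
   occur in the cyclic order z, p, q along H*, the new permutation is one cycle. *)

Require Import Defs.
From mathcomp Require Import all_boot all_order all_fingroup all_algebra.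
From mathcomp Require Import all_classical all_reals all_analysis.
From mathcomp Require Import ring lra zify.

Set Implicit Arguments.
Unset Strict Implicit.
Unset Printing Implicit Defensive.

Import Order.TTheory GRing.Theory Num.Theory.
Local Open Scope classical_set_scope.
Local Open Scope ring_scope.

(** * Orientation of triangles and crossing of chords *)

(** Twice the signed area of the triangle [A B C], negative when it is traversed clockwise. *)
Definition orient (R : realType) (A B C : plane R) : R :=
  (B.1 - A.1) * (C.2 - A.2) - (B.2 - A.2) * (C.1 - A.1).

(* With A, B, C, D the four points in order and [XYZ] = orient X Y Z, the affine
   dependence [BCD] A - [ACD] B + [ABD] C - [ABC] D = 0 exhibits the common point. *)
Lemma orient_chords_intersect (R : realType) (V : finType)
    (P : V -> plane R) (u v w y : V) :
  orient (P u) (P v) (P w) < 0 -> orient (P u) (P v) (P y) < 0 ->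
  orient (P u) (P w) (P y) < 0 -> orient (P v) (P w) (P y) < 0 ->
  chords_intersect P (u, w) (v, y).
Proof.
rewrite /chords_intersect /chord /=.
move: (P u) (P v) (P w) (P y) => A B C D nABC nABD nACD nBCD.
(* Either diagonal cuts the quadrilateral into two triangles, so both sides of the dependence have
   the same total weight [s]. Dividing by [s] gives convex combinations. *)
have sumE : orient A B D + orient B C D = orient A B C + orient A C D.
  by rewrite /orient; ring.
pose s := orient A B D + orient B C D.
have s_lt0 : s < 0 by rewrite /s; lra.
have s_neq0 : s != 0 by rewrite lt_eqF.
exists ((1 - orient A B D / s) *: A + (orient A B D / s) *: C); split.
  exists (orient A B D / s) => //=; rewrite in_itv /=.
  by rewrite ler_ndivlMr // ler_ndivrMr // mul0r mul1r /s; apply/andP; split; lra.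
exists (orient A B C / s).
  rewrite /= in_itv /=.
  by rewrite ler_ndivlMr // ler_ndivrMr // mul0r mul1r /s; apply/andP; split; lra.
have -> : 1 - orient A B C / s = orient A C D / s.
  by apply: (mulIf s_neq0); rewrite mulrBl !divfK // mul1r /s sumE; ring.
have -> : 1 - orient A B D / s = orient B C D / s.
  by apply: (mulIf s_neq0); rewrite mulrBl !divfK // mul1r /s; ring.
apply/pair_equal_spec; split => /=; rewrite /GRing.scale /=;
  apply: (mulIf s_neq0); rewrite !mulrDl;
  do !rewrite -[_ / s * _ * s]mulrA [_ / s * (_ * s)]mulrCA [_ / s * s]divfK //;
  rewrite /orient; ring.
Qed.

(** With doubled angles, [B - A] is [2 r sin (b - a)] times the unit vector orthogonal to the
    direction [a + b], and likewise for [C - A]. The cross product of the two unit vectors is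
    [sin (g - b)]. *)
Lemma orient_circle_point (R : realType) (c : plane R) (r a b g : R) :
  orient (circle_point c r (a *+ 2)) (circle_point c r (b *+ 2))
         (circle_point c r (g *+ 2)) =
  4 * r ^+ 2 * (sin (b - a) * sin (g - a) * sin (g - b)).
Proof.
have cosE u v : cos (v *+ 2) - cos (u *+ 2) = - 2 * sin (u + v) * sin (v - u) :> R.
  rewrite !mulr2n !cosD sinD sinB -!expr2 !cos2sin2.
  transitivity (2 * (sin u ^+ 2 * cos v ^+ 2 - cos u ^+ 2 * sin v ^+ 2)); last by ring.
  by rewrite !cos2sin2; ring.
have sinE u v : sin (v *+ 2) - sin (u *+ 2) = 2 * cos (u + v) * sin (v - u) :> R.
  rewrite !mulr2n !sinD cosD cosN sinN.
  transitivity (2 * (sin v * cos v * (cos u ^+ 2 + sin u ^+ 2)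
                     - sin u * cos u * (cos v ^+ 2 + sin v ^+ 2))); last by ring.
  by rewrite !cos2Dsin2; ring.
have -> : sin (g - b) = sin (a + g) * cos (a + b) - cos (a + g) * sin (a + b).
  by rewrite -sinB; congr sin; ring.
rewrite /orient /circle_point /=.
have D (t u v : R) : t + r * u - (t + r * v) = r * (u - v) by ring.
by rewrite !D !cosE !sinE; ring.
Qed.

(** The differences of half-angles are multiples of [pi / n] lying strictly between [- pi] and [0],
    so the three sines are negative. *)
Lemma orient_circle_lt0 (R : realType) (c : plane R) (r th : R) (n i j k : nat) :
  0 < r -> (i < j < k)%N -> (k < n)%N ->
  let Q m := circle_point c r (th - m%:R * (2 * pi / n%:R)) in
  (orient (Q i) (Q j) (Q k) < 0)%R.
Proof.
move=> r0 /andP[ij jk] kn; set Q := fun _ => _; rewrite /=.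
have n0 : (0 : R) < n%:R by rewrite ltr0n; lia.
have QE m : Q m = circle_point c r ((th / 2 - m%:R * (pi / n%:R)) *+ 2).
  by rewrite /Q; congr circle_point; field; rewrite lt0r_neq0.
have sin_gt0 (l m : nat) : (l < m < n)%N ->
    sin (th / 2 - m%:R * (pi / n%:R) - (th / 2 - l%:R * (pi / n%:R))) < 0.
  move=> /andP[lm mn].
  have -> : th / 2 - m%:R * (pi / n%:R) - (th / 2 - l%:R * (pi / n%:R)) =
      - ((m - l)%:R * (pi / n%:R)).
    by rewrite natrB ?(ltnW lm) //; ring.
  rewrite sinN oppr_lt0; apply: sin_gt0_pi; apply/andP; split.
    by apply: mulr_gt0; [rewrite ltr0n subn_gt0 | rewrite divr_gt0 ?pi_gt0].
  by rewrite mulrCA gtr_pMr ?pi_gt0 // ltr_pdivrMr // mul1r ltr_nat; lia.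
rewrite !QE orient_circle_point.
have h1 : (i < j < n)%N by lia.
have h2 : (i < k < n)%N by lia.
have h3 : (j < k < n)%N by lia.
rewrite pmulr_rlt0; last by rewrite mulr_gt0 // exprn_gt0.
by rewrite nmulr_llt0 ?nmulr_lgt0 ?sin_gt0.
Qed.

(** * Positions along an n-cycle *)

Lemma ncycle_fconnect (V : finType) (H : {perm V}) (u v : V) :
  ncycle H -> fconnect H u v.
Proof.
by move=> /(_ u v) /porbitP[i ->]; rewrite permX; apply: fconnect_iter.
Qed.

Lemma fconnect_ncycle (V : finType) (H : {perm V}) (u : V) :
  (forall v, fconnect H u v) -> ncycle H.
Proof.
move=> Hu v w; apply/porbitP; exists (findex H v w).
rewrite permX iter_findex //; apply: (connect_trans (y := u)) => //.
by rewrite fconnect_sym //; apply: perm_inj.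
Qed.

Lemma order_ncycle (V : finType) (H : {perm V}) (u : V) :
  ncycle H -> fingraph.order H u = #|V|.
Proof. by move=> Hc; apply: eq_card => v; rewrite !inE ncycle_fconnect. Qed.

Lemma iter_card_ncycle (V : finType) (H : {perm V}) (u : V) :
  ncycle H -> iter #|V| H u = u.
Proof. by move=> Hc; rewrite -(order_ncycle u Hc) iter_order //; apply: perm_inj. Qed.

Lemma ncycle_iter (V : finType) (H : {perm V}) (u v : V) :
  ncycle H -> exists2 m, (m < #|V|)%N & v = iter m H u.
Proof.
move=> Hc; have Huv := ncycle_fconnect u v Hc; exists (findex H u v).
  by rewrite -(order_ncycle u Hc) findex_max.
by rewrite iter_findex.
Qed.

Lemma iter_ncycle_inj (V : finType) (H : {perm V}) (u : V) (i j : nat) :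
  ncycle H -> (i < #|V|)%N -> (j < #|V|)%N -> (iter i H u == iter j H u) = (i == j).
Proof.
move=> Hc iV jV; apply/eqP/eqP => [E|-> //].
by rewrite -(findex_iter (x := u) (f := H) (i := i)) ?E ?findex_iter ?order_ncycle.
Qed.

Lemma findex_ncycle (V : finType) (H : {perm V}) (u : V) (j m : nat) :
  ncycle H -> (m < #|V|)%N -> findex H (iter j H u) (iter (m + j) H u) = m.
Proof. by move=> Hc mV; rewrite iterD findex_iter ?order_ncycle. Qed.

(** Lets a modified successor function inherit connections from the circuit [g] along a stretch
    where the two agree. *)
Lemma fconnect_iter_chain (V : finType) (f : V -> V) (g : V -> V) (u : V) (i j : nat) :
  (i <= j)%N ->
  (forall m, (i <= m < j)%N -> f (iter m g u) = iter m.+1 g u) ->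
  fconnect f (iter i g u) (iter j g u).
Proof.
move=> ij fE; elim: j ij fE => [|j IHj].
  by rewrite leqn0 => /eqP-> _.
rewrite leq_eqVlt => /orP[/eqP<- // | ij fE].
apply: connect_trans (IHj ij _) _ => [m ?|]; first by apply: fE; lia.
by rewrite -fE ?fconnect1 //; lia.
Qed.

(** * Admissibility of pseudo-3-cycles *)

Lemma cycle3E (V : finType) (p q z : V) : uniq [:: p; q; z] ->
  [/\ cycle3 p q z p = q, cycle3 p q z q = z, cycle3 p q z z = p &
      forall v, v \notin [:: p; q; z] -> cycle3 p q z v = v].
Proof.
rewrite /= !inE negb_or => /and3P[/andP[pq pz] qz _]; rewrite /cycle3; split.
- by rewrite permM tpermL tpermD // eq_sym.
- by rewrite permM tpermR tpermL.
- by rewrite permM [tperm p q z]tpermD ?tpermR.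
- move=> v; rewrite !inE !negb_or => /and3P[vp vq vz].
  by rewrite permM !tpermD // eq_sym.
Qed.

(** The new permutation sends position [s] to [k + 1], [i] to [s + 1] and [k] to [i + 1]. It thus
    runs through [0..s], [k+1..i], [s+1..k], [i+1..#|V|] in this order, exchanging the two middle
    stretches. *)
Lemma admissible3_iter (V : finType) (H : {perm V}) (u : V) (s k i : nat) :
  ncycle H -> (s < k < i)%N -> (i < #|V|)%N ->
  admissible3 H (iter k H u) (iter i H u) (iter s H u).
Proof.
move=> Hc /andP[sk ki] iV; pose g m := iter m H u.
rewrite /admissible3 -/(g k) -/(g i) -/(g s).
have gE l m : (l < #|V|)%N -> (m < #|V|)%N -> (g l == g m) = (l == m).
  exact: iter_ncycle_inj.
have U : uniq [:: g k; g i; g s] by rewrite /= !inE !gE //; lia.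
have [cp cq cz cD] := cycle3E U; set f := (_ * H)%g.
have fp : f (g k) = g i.+1 by rewrite /f permM cp.
have fq : f (g i) = g s.+1 by rewrite /f permM cq.
have fz : f (g s) = g k.+1 by rewrite /f permM cz.
have chain l m : (l <= m <= #|V|)%N ->
    (forall t, (l <= t < m)%N -> [&& t != s, t != k & t != i]) ->
    fconnect f (g l) (g m).
  move=> /andP[lm mV] D; apply: fconnect_iter_chain => // t /[dup] tlm /D.
  by rewrite permM -/(g t) => ?; rewrite cD // !inE !gE; lia.
have fsym v w : fconnect f v w -> fconnect f w v.
  by rewrite fconnect_sym //; apply: perm_inj.
have g0 : g #|V| = u by apply: iter_card_ncycle.
apply: (fconnect_ncycle (u := u)) => v; apply: fsym.
have [m mV ->] := ncycle_iter u v Hc; rewrite -/(g m).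
(* The stretches are linked to [u] from the last one backwards; position [#|V|] is [u] again. *)
have hi : fconnect f (g i.+1) u by rewrite -g0; apply: chain => [|t]; lia.
have hk : fconnect f (g k) u by rewrite (connect_trans (fconnect1 _ _)) ?fp.
have hi' : fconnect f (g i) u.
  rewrite (connect_trans (fconnect1 _ _)) // fq.
  by apply: connect_trans hk; apply: chain => [|t]; lia.
have hk' : fconnect f (g k.+1) u.
  by apply: connect_trans hi'; apply: chain => [|t]; lia.
have hs' : fconnect f (g s) u by rewrite (connect_trans (fconnect1 _ _)) ?fz.
case: (leqP m s) => ms; first by apply: connect_trans hs'; apply: chain => [|t]; lia.
case: (leqP m k) => mk; first by apply: connect_trans hk; apply: chain => [|t]; lia.
case: (leqP m i) => mi; first by apply: connect_trans hi'; apply: chain => [|t]; lia.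
by rewrite -g0; apply: chain => [|t]; lia.
Qed.

(** * Rotations as maps of positions *)

Lemma nth_rotation_seq (V : finType) (H : {perm V}) (a : V) (k m : nat) :
  ncycle H -> (0 < k < #|V|)%N -> (m < #|V|)%N ->
  nth a (rotation_seq H a (iter k H a)) m =
  iter (if (0 < m <= k)%N then (k.+1 - m)%N else m) H a.
Proof.
move=> Hc /andP[k0 kV] mV; rewrite /rotation_seq.
set s := behead _.
have orbE : fingraph.orbit H a = a :: s by rewrite /s /fingraph.orbit -orderSpred.
have size_s : size s = #|V|.-1.
  by rewrite size_behead size_orbit order_ncycle.
have sE j : (j < #|V|.-1)%N -> nth a s j = iter j.+1 H a.
  move=> jV; rewrite -[LHS]/(nth a (a :: s) j.+1) -orbE nth_traject //.
  by rewrite order_ncycle //; lia.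
have s_uniq : uniq s.
  by have := fingraph.orbit_uniq H a; rewrite orbE => /andP[].
(* [s] starts at [H a], not at [a], so [x] has index [k - 1] in it and [take k s] ends with [x]. *)
have -> : index (iter k H a) s = k.-1.
  by rewrite -[in iter k H a](prednK k0) -sE ?index_uniq ?size_s //; lia.
rewrite (prednK k0); case: m mV => [//|m] mV /=.
have size_t : size (take k s) = k by rewrite size_takel // size_s; lia.
rewrite nth_cat size_rev size_t; case: (ltnP m k) => mk.
  rewrite nth_rev size_t // nth_take ?sE; try lia.
  by congr (iter _ H a); lia.
by rewrite nth_drop sE; [congr (iter _ H a)|]; lia.
Qed.

Lemma size_rotation_seq (V : finType) (H : {perm V}) (a x : V) :
  ncycle H -> size (rotation_seq H a x) = #|V|.
Proof.
move=> Hc; rewrite /rotation_seq /= size_cat size_rev -size_cat cat_take_drop.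
rewrite size_behead size_orbit order_ncycle // prednK //.
by apply/card_gt0P; exists a.
Qed.

Lemma iter_next (V : eqType) (u : V) (s : seq V) (m : nat) :
  uniq (u :: s) -> (m < size (u :: s))%N ->
  iter m (next (u :: s)) u = nth u (u :: s) m.
Proof.
move=> us; elim: m => [//|m IHm] ms; rewrite iterS IHm ?(ltnW ms) //.
by rewrite next_nth mem_nth ?(ltnW ms) // index_uniq ?(ltnW ms).
Qed.

Lemma iter_rotation (V : finType) (H : {perm V}) (a : V) (k m : nat) :
  ncycle H -> (0 < k < #|V|)%N -> (m < #|V|)%N ->
  iter m (rotation H a (iter k H a)) a =
  iter (if (0 < m <= k)%N then (k.+1 - m)%N else m) H a.
Proof.
move=> Hc kV mV; rewrite -nth_rotation_seq //.
rewrite (eq_iter (f' := next (rotation_seq H a (iter k H a)))) => [|v]; last exact: permE.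
have := rotation_seq_uniq H a (iter k H a).
have := size_rotation_seq a (iter k H a) Hc.
by rewrite /rotation_seq => sE us; rewrite iter_next // sE.
Qed.

Lemma ncycle_rotation (V : finType) (H : {perm V}) (a : V) (k : nat) :
  ncycle H -> (0 < k < #|V|)%N -> ncycle (rotation H a (iter k H a)).
Proof.
move=> Hc kV; apply: (fconnect_ncycle (u := a)) => v.
have [m mV ->] := ncycle_iter a v Hc.
(* The position map is an involution, so the same formula gives the preimage of [m]. *)
pose l := if (0 < m <= k)%N then (k.+1 - m)%N else m.
have -> : iter m H a = iter l (rotation H a (iter k H a)) a.
  rewrite iter_rotation //; last by rewrite /l; case: ifP; lia.
  by congr (iter _ H a); rewrite /l; do !case: ifP; lia.
exact: fconnect_iter.
Qed.

(** * Alternating endpoints and intersecting chords *)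

(** Counting from [u] instead of [v0] only shifts the initial angle. *)
Lemma clockwise_chords_intersect (R : realType) (V : finType) (H : {perm V})
    (c : plane R) (r : R) (P : V -> plane R) (u : V) (i j k l : nat) :
  ncycle H -> clockwise_on H c r P ->
  (i < j)%N -> (j < k)%N -> (k < l)%N -> (l < #|V|)%N ->
  chords_intersect P (iter i H u, iter k H u) (iter j H u, iter l H u).
Proof.
move=> Hc [r0 [v0 [th PE]]] ij jk kl lV.
have [m _ ->] := ncycle_iter v0 u Hc.
have PmE t : P (iter t H (iter m H v0)) =
    circle_point c r (th - m%:R * (2 * pi / #|V|%:R) - t%:R * (2 * pi / #|V|%:R)).
  by rewrite -iterD PE; congr circle_point; rewrite natrD; ring.
by apply: orient_chords_intersect; rewrite !PmE; apply: orient_circle_lt0 => //; lia.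
Qed.

Lemma chord_swap (R : realType) (V : finType) (P : V -> plane R) (u v : V) :
  chord P (u, v) = chord P (v, u).
Proof.
suff sub w y : chord P (w, y) `<=` chord P (y, w) by apply/seteqP.
move=> _ [t + <-]; rewrite /= in_itv /= => /andP[t0 t1].
exists (1 - t); first by rewrite /= in_itv /=; apply/andP; split; lra.
by rewrite subKr addrC.
Qed.

Lemma chords_intersectC (R : realType) (V : finType) (P : V -> plane R)
    (e1 e2 : V * V) :
  chords_intersect P e1 e2 -> chords_intersect P e2 e1.
Proof. by rewrite /chords_intersect setIC. Qed.

Lemma chords_intersect_swapr (R : realType) (V : finType) (P : V -> plane R)
    (e : V * V) (u v : V) :
  chords_intersect P e (u, v) -> chords_intersect P e (v, u).
Proof. by rewrite /chords_intersect (chord_swap P u v). Qed.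

Lemma chords_intersect_common (R : realType) (V : finType) (P : V -> plane R)
    (u v w : V) :
  chords_intersect P (u, v) (u, w).
Proof.
exists (P u); split; exists 0; rewrite /= ?in_itv /= ?lexx ?ler01 //.
  by rewrite subr0 scale1r scale0r addr0.
by rewrite subr0 scale1r scale0r addr0.
Qed.

(** * The rotated circuit *)

Lemma rotation_admissible (R : realType) (V : finType) (adj : rel V)
    (H : {perm V}) (c : plane R) (r : R) (P : V -> plane R) (a d e x : V) :
  irreflexive adj -> ncycle H -> clockwise_on H c r P ->
  edge_off adj H (H a, H d) -> edge_off adj H (d, H e) ->
  ~ chords_intersect P (H a, H d) (d, H e) ->
  edge_off adj H (a, x) ->
  pseudo_arc_vertex adj (rotation H a x) (H a) ->
  cw_between H (H e) x d ->
  (forall (c' : plane R) (r' : R) (P' : V -> plane R),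
     clockwise_on (rotation H a x) c' r' P' ->
     chords_intersect P' (H a, H d) (d, H e)) /\
  (exists p q z : V,
     determines_pseudo_3cycle adj (rotation H a x) (H a, H d) (d, H e) p q z /\
     admissible3 (rotation H a x) p q z).
Proof.
move=> adjI Hc cw /and3P[/= adj1 _ Hd_Ha] /and3P[/= adj2 _ _] Nint.
move=> /and3P[/= adjx Ha_x _] arcHa.
have [k kV xE] := ncycle_iter a x Hc.
have [i iV dE] := ncycle_iter a d Hc.
have [j jV eE] := ncycle_iter a (H e) Hc.
have HdE : H d = iter i.+1 H a by rewrite dE.
have HaE : H a = iter 1 H a by [].
have aE : iter #|V| H a = a by apply: iter_card_ncycle.
have i_neq0 : i != 0%N by apply: contraTneq adj1 => i0; rewrite dE i0 adjI.
(* Otherwise [H d = a], and [e1] would be an arc of [H]. *)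
have i_lt : (i.+1 < #|V|)%N.
  have /predU1P[iE|//] : (i.+1 == #|V|) || (i.+1 < #|V|)%N by rewrite -leq_eqVlt.
  by rewrite HdE iE aE eqxx in Hd_Ha.
(* Chords are closed, so a shared endpoint already contradicts [Nint]. This excludes [d = H a], and
   below [H e = H a] and [H e = H d]. *)
have i_neq1 : i != 1%N.
  apply/eqP => i1; apply: Nint; rewrite {2}dE i1.
  exact: chords_intersect_common.
have j_neqi : j != i by apply: contraTneq adj2 => ji; rewrite eE ji -dE adjI.
have j_neq1 : j != 1%N.
  apply/eqP => j1; apply: Nint; rewrite eE j1; apply: chords_intersect_swapr.
  exact: chords_intersect_common.
have j_neqSi : j != i.+1.
  apply/eqP => ji; apply: Nint; rewrite eE ji -HdE.
  apply/chords_intersectC/chords_intersect_swapr/chords_intersectC.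
  apply: chords_intersect_swapr; exact: chords_intersect_common.
(* The endpoints alternate at [0 < 1 < i < i + 1] when [j = 0], and at [1 < i < i + 1 < j] when [j]
   exceeds [i + 1]. *)
have j_neq0 : j != 0%N.
  apply/eqP => j0; apply: Nint; rewrite eE j0 HdE dE HaE.
  apply: chords_intersect_swapr; apply: chords_intersectC.
  by apply: (clockwise_chords_intersect _ Hc cw); lia.
have j_lei : (j <= i.+1)%N.
  rewrite leqNgt; apply/negP => ij; apply: Nint; rewrite eE HdE dE HaE.
  by apply: (clockwise_chords_intersect _ Hc cw); lia.
have k_neq0 : k != 0%N by apply: contraTneq adjx => k0; rewrite xE k0 adjI.
have k_neq1 : k != 1%N by apply: contraNneq Ha_x => k1; rewrite xE k1.
rewrite /cw_between eE dE.
have -> : findex H (iter j H a) (iter i H a) = (i - j)%N.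
  by rewrite -{1}(subnK (m := j) (n := i)) ?findex_ncycle //; lia.
(* If [x] came before [H e], the walk from [H e] to [x] would pass through [a] and take
   [k + #|V| - j] steps, more than the [i - j] steps to [d]. *)
have [kj|jk] := ltnP k j.
  have -> : x = iter (k + #|V| - j + j) H a.
    by rewrite xE -{1}aE -iterD; congr (iter _ H a); lia.
  by rewrite findex_ncycle //; lia.
have -> : x = iter (k - j + j) H a by rewrite xE; congr (iter _ H a); lia.
rewrite findex_ncycle //; last by lia.
have -> : iter (k - j + j) H a = x by rewrite xE; congr (iter _ H a); lia.
move=> kji; rewrite -dE -eE.
have kV' : (0 < k < #|V|)%N by lia.
have gE m : (m < #|V|)%N -> iter m (rotation H a x) a =
    iter (if (0 < m <= k)%N then (k.+1 - m)%N else m) H a.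
  by rewrite xE; apply: iter_rotation.
have Hc' : ncycle (rotation H a x) by rewrite xE; apply: ncycle_rotation.
set H' := rotation H a x in arcHa gE Hc' *.
have gHa : H a = iter k H' a.
  by rewrite gE // HaE; congr (iter _ H a); case: ifP; lia.
have k_neqi : k != i.
  apply: contraNneq arcHa => ki; suff -> : H' (H a) = H d by [].
  by rewrite gHa -iterS gE ?HdE; [congr (iter _ H a); case: ifP; lia | lia].
have gHd : H d = iter i.+1 H' a.
  by rewrite gE // HdE; congr (iter _ H a); case: ifP; lia.
have gd : d = iter i H' a.
  by rewrite gE // dE; congr (iter _ H a); case: ifP; lia.
have gHe : H e = iter (k - j).+1 H' a.
  by rewrite gE ?eE; [congr (iter _ H a); case: ifP; lia | lia].
split=> [c' r' P' cw'|].
  (* Along [H'] the order is [H e], [H a], [d], [H d]; the first inequality is strict because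
     [1 < j]. *)
  rewrite gHa gHd gHe gd; apply/chords_intersect_swapr/chords_intersectC.
  by apply: (clockwise_chords_intersect _ Hc' cw'); lia.
(* The third vertex must be the predecessor of [H e] along [H']; it is [a] itself when [x = H e]. *)
exists (H a), d, (iter (k - j) H' a); split; last first.
  by rewrite gHa gd; apply: admissible3_iter => //; lia.
(* Since [k < i], the vertex [d] lies beyond the reversed segment and keeps its successor. *)
have H'd : H' d = H d by rewrite gHd iterS -gd.
split; rewrite ?H'd -?iterS -?gHe //.
by rewrite gHa gd /= !inE !iter_ncycle_inj //; lia.
Qed.

Theorem theoremR :
  forall (R : realType) (T : finType) (G : rel T),
    symmetric G -> irreflexive G -> hamiltonian G ->
  forall (H : {perm (contracted_vertex G)}), ncycle H ->
  forall (c : plane R) (r : R) (P : contracted_vertex G -> plane R),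
    clockwise_on H c r P ->
  forall a d e x : contracted_vertex G,
    pseudo_arc_vertex (@contracted T G) H a ->
    edge_off (@contracted T G) H (H a, H d) ->
    edge_off (@contracted T G) H (d, H e) ->
    ~ chords_intersect P (H a, H d) (d, H e) ->
    edge_off (@contracted T G) H (a, x) ->
    pseudo_arc_vertex (@contracted T G) (rotation H a x) (H a) ->
    cw_between H (H e) x d ->
  (forall (c' : plane R) (r' : R) (P' : contracted_vertex G -> plane R),
     clockwise_on (rotation H a x) c' r' P' ->
     chords_intersect P' (H a, H d) (d, H e)) /\
  (exists p q z : contracted_vertex G,
     determines_pseudo_3cycle (@contracted T G) (rotation H a x)
       (H a, H d) (d, H e) p q z /\
     admissible3 (rotation H a x) p q z).
Proof.
move=> R T G _ _ _ H Hc c r P cw a d e x _.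
apply: rotation_admissible Hc cw => y.
by rewrite /contracted eqxx.
Qed.
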